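(* Intuitionistic propositional logic is sound and complete with respect to semilattice semantics: for every formula $\phi$ built from proposition letters, $\top,\bot,\wedge,\vee,\to$, $\phi$ is a theorem of intuitionistic propositional logic if and only if $x\Vdash\phi$ for every point $x$ of every distributive semilattice model $(X,1,\curlywedge,V)$.
   Context: A meet-semilattice $(X,1,\curlywedge)$ has top $1$ and order $x\preccurlyeq y$ iff $x\curlywedge y=x$; it is distributive if whenever $x\curlywedge y\preccurlyeq z$ there exist $u,v$ with $x\preccurlyeq u$, $y\preccurlyeq v$ and $z=u\curlywedge v$. A filter is an upward closed subset closed under finite meets. A distributive semilattice model is a distributive meet-semilattice $(X,1,\curlywedge)$ with a valuation $V$ assigning a filter to each proposition letter. Truth is defined recursively: $x\Vdash p$ iff $x\in V(p)$; $x\Vdash\top$ always; $x\Vdash\bot$ iff $x=1$; $x\Vdash\phi\wedge\psi$ iff $x\Vdash\phi$ and $x\Vdash\psi$; $x\Vdash\phi\vee\psi$ iff there exist $y,z\in X$ with $y\Vdash\phi$, $z\Vdash\psi$ and $y\curlywedge z\preccurlyeq x$; $x\Vdash\phi\to\psi$ iff for all $y$ with $x\preccurlyeq y$, $y\Vdash\phi$ implies $y\Vdash\psi$. *)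

(* Defs.v *)
From HB Require Import structures.
From mathcomp Require Import all_boot all_order all_classical.

Set Implicit Arguments.
Unset Strict Implicit.
Unset Printing Implicit Defensive.

Import Order.TTheory.
Local Open Scope order_scope.

Inductive form (P : Type) : Type :=
| Var : P -> form P
| Top : form P
| Bot : form P
| And : form P -> form P -> form P
| Or : form P -> form P -> form P
| Imp : form P -> form P -> form P.

Arguments Top {P}.
Arguments Bot {P}.

Declare Scope form_scope.
Delimit Scope form_scope with form.
Bind Scope form_scope with form.
Notation "⊤" := Top (at level 0) : form_scope.
Notation "⊥" := Bot (at level 0) : form_scope.
Notation "a ∧ b" := (And a b) (at level 80, right associativity) : form_scope.
Notation "a ∨ b" := (Or a b) (at level 85, right associativity) : form_scope.
Notation "a → b" := (Imp a b) (at level 99, b at level 200) : form_scope.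

(* Hilbert calculus; the axioms are schemas, so no substitution rule. *)
Inductive ipl_theorem (P : Type) : form P -> Prop :=
| ipl_K a b : ipl_theorem (a → b → a)
| ipl_S a b c : ipl_theorem ((a → b → c) → (a → b) → a → c)
| ipl_andE1 a b : ipl_theorem ((a ∧ b) → a)
| ipl_andE2 a b : ipl_theorem ((a ∧ b) → b)
| ipl_andI a b : ipl_theorem (a → b → (a ∧ b))
| ipl_orI1 a b : ipl_theorem (a → (a ∨ b))
| ipl_orI2 a b : ipl_theorem (b → (a ∨ b))
| ipl_orE a b c : ipl_theorem ((a → c) → (b → c) → (a ∨ b) → c)
| ipl_top : ipl_theorem ⊤
| ipl_bot a : ipl_theorem (⊥ → a)
| ipl_mp a b : ipl_theorem (a → b) -> ipl_theorem a -> ipl_theorem b.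

Definition distributive_semilattice d (X : tMeetSemilatticeType d) : Prop :=
  forall x y z : X, x `&` y <= z ->
    exists u v : X, [/\ x <= u, y <= v & z = u `&` v].

(* "Finite meets" include the empty meet, so a filter contains \top. *)
Record semilattice_filter d (X : tMeetSemilatticeType d) (F : set X) : Prop := {
  filter_upward : forall x y : X, x <= y -> F x -> F y;
  filter_top : F \top;
  filter_meet : forall x y : X, F x -> F y -> F (x `&` y)
}.

(* MathComp semilattices have choiceType carriers and boolean orders; classically
   (boolp) this is no restriction. [ds_disp] is only a notation tag. *)
Record ds_model (P : Type) := DSModel {
  ds_disp : Order.disp_t;
  ds_points :> tMeetSemilatticeType ds_disp;
  ds_distr : distributive_semilattice ds_points;
  ds_val : P -> set ds_points;
  ds_val_filter : forall p, semilattice_filter (ds_val p)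
}.

Fixpoint sat (P : Type) (M : ds_model P) (x : M) (a : form P) : Prop :=
  match a with
  | Var p => ds_val p x
  | Top => True
  | Bot => x = \top
  | And b c => sat x b /\ sat x c
  | Or b c => exists y z : M, [/\ sat y b, sat z c & y `&` z <= x]
  | Imp b c => forall y : M, x <= y -> sat y b -> sat y c
  end.

Notation "x ⊩ a" := (sat x a%form) (at level 70, no associativity).

(* Main.v *)
(* Soundness: distributivity makes the truth set of every formula a filter (the
   implication case), and, used once more, it validates disjunction elimination.
   Completeness: the Lindenbaum algebra of intuitionistic logic with its order
   reversed is a distributive semilattice, meets being disjunctions and the top
   being falsum; there the class of [a] forces [b] if and only if [a] entails [b].
   The class of [a] is represented by the theory of all [b] entailed by [a], so
   that the reversed order becomes inclusion and the meet intersection. *)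

Require Import Defs.
From HB Require Import structures.
From mathcomp Require Import all_boot all_order all_classical.

Set Implicit Arguments.
Unset Strict Implicit.
Unset Printing Implicit Defensive.

Import Order.TTheory.
Local Open Scope order_scope.

(** * Truth sets and soundness *)

Lemma sat_filter (P : Type) (M : ds_model P) (a : form P) :
  semilattice_filter (fun x : M => x ⊩ a).
Proof.
elim: a => [p|||a [ua ta ma] b [ub tb mb]|a [ua ta ma] b [ub tb mb]
           |a [ua ta ma] b [ub tb mb]] /=; split.
- by case: (ds_val_filter M p).
- by case: (ds_val_filter M p).
- by case: (ds_val_filter M p).
- by [].
- by [].
- by [].
- by move=> x y xy x1; apply/eqP; rewrite -le1x -x1.
- by [].
- by move=> x y -> ->; rewrite meetxx.
- by move=> x y xy [xa xb]; split; [exact: ua xa|exact: ub xb].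
- by [].
- by move=> x y [xa xb] [ya yb]; split; [exact: ma|exact: mb].
- move=> x y xy [s [t [sa rb st]]]; exists s, t; split=> //.
  exact: le_trans xy.
- by exists \top, \top; split=> //; exact: lex1.
- move=> x y [s [t [sa rb st]]] [s' [t' [sa' rb' st']]].
  exists (s `&` s'), (t `&` t'); split; [exact: ma|exact: mb|].
  by rewrite meetACA leI2.
- by move=> x y xy xab z yz; apply: xab; exact: le_trans yz.
- by move=> y; rewrite le1x => /eqP ->.
(* Both [u] and [v] lie above [z], so they force [a]; hence they force [b], and so does their meet
   [z]. *)
- move=> x y xab yab z /ds_distr-[u [v [xu yv zE]]] za; rewrite zE.
  apply: mb; [apply: xab => //|apply: yab => //]; apply: ua za; rewrite zE.
    exact: leIl.
  exact: leIr.
Qed.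

Lemma sat_upward (P : Type) (M : ds_model P) (a : form P) (x y : M) :
  x <= y -> x ⊩ a -> y ⊩ a.
Proof. exact: (filter_upward (sat_filter M a)). Qed.

Lemma sat_top (P : Type) (M : ds_model P) (a : form P) : (\top : M) ⊩ a.
Proof. exact: (filter_top (sat_filter M a)). Qed.

Lemma sat_meet (P : Type) (M : ds_model P) (a : form P) (x y : M) :
  x ⊩ a -> y ⊩ a -> x `&` y ⊩ a.
Proof. exact: (filter_meet (sat_filter M a)). Qed.

Lemma ipl_sound (P : Type) (a : form P) :
  ipl_theorem a -> forall (M : ds_model P) (x : M), x ⊩ a.
Proof.
elim=> {a} [a b|a b c|a b|a b|a b|a b|a b|a b c||a|a b _ ab _ ha] M x //=.
- by move=> y _ ya z yz _; exact: sat_upward yz ya.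
- move=> y _ yabc z yz zab t zt ta.
  by apply: (yabc t) => //; [exact: le_trans zt|exact: zab].
- by move=> y _ [].
- by move=> y _ [].
- by move=> y _ ya z yz zb; split=> //; exact: sat_upward yz ya.
(* [\top] forces every formula, so it serves as the point for the other disjunct. *)
- move=> y _ ya; exists y, \top; split=> //; last by rewrite leIl.
  exact: sat_top.
- move=> y _ yb; exists \top, y; split=> //; last by rewrite leIr.
  exact: sat_top.
(* The witnesses [s], [r] need not lie above [t], so the two implications do not apply to them.
   Distributivity replaces them by [u] and [v], which do and whose meet is [t]. *)
- move=> y _ yac z yz zbc t zt [s [r [sa rb /ds_distr-[u [v [su rv tE]]]]]].
  have tu : t <= u by rewrite tE leIl.
  have tv : t <= v by rewrite tE leIr.
  rewrite tE; apply: sat_meet.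
    apply: yac; first exact: le_trans yz (le_trans zt tu).
    exact: sat_upward su sa.
  apply: zbc; first exact: le_trans zt tv.
  exact: sat_upward rv rb.
- by move=> y _ ->; exact: sat_top.
- exact: ab (lexx x) (ha M x).
Qed.

(** * Derived rules of the Hilbert calculus *)

Definition entails (P : Type) (a b : form P) : Prop := ipl_theorem (a → b).
Local Notation "a ⊢ b" := (entails a%form b%form) (at level 199, no associativity).

Lemma entails_theorem (P : Type) (a b : form P) : ipl_theorem b -> a ⊢ b.
Proof. exact/ipl_mp/ipl_K. Qed.

Lemma entails_mp (P : Type) (a b c : form P) : (a ⊢ b → c) -> (a ⊢ b) -> (a ⊢ c).
Proof. by move=> abc; apply: ipl_mp; apply: ipl_mp abc; exact: ipl_S. Qed.

Lemma entails_trans (P : Type) (a b c : form P) : (a ⊢ b) -> (b ⊢ c) -> (a ⊢ c).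
Proof. by move=> ab bc; apply: entails_mp ab; exact: entails_theorem. Qed.

Lemma entails_refl (P : Type) (a : form P) : a ⊢ a.
Proof. exact: entails_mp (ipl_K a (a → a)%form) (ipl_K a a). Qed.

Lemma entails_and (P : Type) (a b c : form P) :
  (a ⊢ b) -> (a ⊢ c) -> (a ⊢ b ∧ c).
Proof.
by move=> ab; apply: entails_mp; apply: entails_trans ab _; exact: ipl_andI.
Qed.

Lemma entails_or (P : Type) (a b c : form P) :
  (a ⊢ c) -> (b ⊢ c) -> (a ∨ b ⊢ c).
Proof. by move=> ac; apply: ipl_mp; apply: ipl_mp ac; exact: ipl_orE. Qed.

Lemma entails_imp (P : Type) (a b c : form P) : (a ∧ b ⊢ c) <-> (a ⊢ b → c).
Proof.
split=> [abc|abc].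
  (* Pairing gives [a ⊢ b → a ∧ b]; the axiom [ipl_S] composes this with [abc] under the hypothesis
     [b]. *)
  apply: entails_mp (ipl_andI a b).
  apply: entails_theorem; apply: ipl_mp (ipl_S _ _ _) _.
  exact: entails_theorem.
apply: entails_mp (ipl_andE2 a b).
exact: entails_trans (ipl_andE1 a b) abc.
Qed.

(** * The reversed Lindenbaum algebra *)

Definition theory (P : Type) (a : form P) : set (form P) := fun b => a ⊢ b.

(** This keeps principal theories closed under intersection, so that the meet of sets restricts to
    them. *)
Lemma theory_or (P : Type) (a b : form P) :
  theory (a ∨ b) = (theory a `&` theory b)%classic.
Proof.
apply/seteqP; split=> c /=; last by case; exact: entails_or.
move=> abc; split; [exact: entails_trans (ipl_orI1 a b) abc
                   |exact: entails_trans (ipl_orI2 a b) abc].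
Qed.

Definition principal (P : Type) : pred (set (form P)) :=
  fun T => `[< exists a, T = theory a >].

Definition lindenbaum (P : Type) : Type := {T : set (form P) | principal T}.

HB.instance Definition _ (P : Type) := SubChoice.on (lindenbaum P).
HB.instance Definition _ (P : Type) := [SubChoice_isSubPOrder of lindenbaum P by <: with set_display].

Lemma principal_theory (P : Type) (a : form P) : principal (theory a).
Proof. by apply/asboolP; exists a. Qed.

Definition class (P : Type) (a : form P) : lindenbaum P :=
  Sub (theory a) (principal_theory a).

Lemma classP (P : Type) (x : lindenbaum P) : exists a, x = class a.
Proof.
by case: (x) (valP x) => T pT /= /asboolP[a Ta]; exists a; exact/val_inj.
Qed.

(** Inclusion of theories is tested at the generator [a], which lies in its own theory; the converse
    is transitivity. *)
Lemma le_class (P : Type) (a b : form P) : (class a <= class b) <-> (b ⊢ a).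
Proof.
rewrite -(rwP (subsetPset (theory a) (theory b))).
split=> [/(_ a)|ba c]; first by apply; exact: entails_refl.
exact: entails_trans ba.
Qed.

Lemma principal_setI (P : Type) (x y : lindenbaum P) :
  principal (val x `&` val y)%classic.
Proof.
have [[a ->] [b ->]] := (classP x, classP y).
by apply/asboolP; exists (a ∨ b)%form; rewrite theory_or.
Qed.

Definition lindenbaum_meet (P : Type) (x y : lindenbaum P) : lindenbaum P :=
  Sub _ (principal_setI x y).

Lemma le_lindenbaum_meet (P : Type) (x y z : lindenbaum P) :
  (x <= lindenbaum_meet y z) = (x <= y) && (x <= z).
Proof. exact: (lexI (val x) (val y) (val z)). Qed.

Lemma le_class_bot (P : Type) (x : lindenbaum P) : x <= class ⊥.
Proof. by have [a ->] := classP x; apply/le_class; exact: ipl_bot. Qed.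

HB.instance Definition _ (P : Type) :=
  Order.POrder_isMeetSemilattice.Build _ (lindenbaum P) (@le_lindenbaum_meet P).
HB.instance Definition _ (P : Type) :=
  Order.hasTop.Build _ (lindenbaum P) (@le_class_bot P).

Lemma meet_class (P : Type) (a b : form P) :
  class a `&` class b = class (a ∨ b).
Proof. by apply/val_inj; rewrite /= theory_or. Qed.

Lemma lindenbaum_distr (P : Type) : distributive_semilattice (lindenbaum P).
Proof.
move=> x y z; have [[[a ->] [b ->]] [c ->]] := (classP x, classP y, classP z).
rewrite meet_class => /le_class cab.
(* Since [c ⊢ a ∨ b], the formula [c] is equivalent to [(a ∧ c) ∨ (b ∧ c)]. *)
exists (class (a ∧ c)), (class (b ∧ c)); split.
- by apply/le_class; exact: ipl_andE1.
- by apply/le_class; exact: ipl_andE1.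
rewrite meet_class; apply/le_anti/andP; split; apply/le_class.
  by apply: entails_or; exact: ipl_andE2.
(* The premise [c] is used twice: once to obtain [a ∨ b], and again inside each case, where
   residuation moves it to the right. *)
apply: entails_mp (entails_refl c); apply: entails_trans cab _.
apply: entails_or; apply/entails_imp; [exact: ipl_orI1|exact: ipl_orI2].
Qed.

(** The order is inclusion, the top is the theory of [⊥], which contains everything, and meets are
    intersections. *)
Lemma lindenbaum_val_filter (P : Type) (p : P) :
  semilattice_filter (fun x : lindenbaum P => val x (Var p)).
Proof.
split=> [x y /subsetPset|//|x y]; [exact|exact: ipl_bot|by split].
Qed.

Definition lindenbaum_model (P : Type) : ds_model P :=
  DSModel (@lindenbaum_distr P) (@lindenbaum_val_filter P).

(** The truth lemma, by induction on [b] for all [a] at once, since disjunction and implication move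
    to other points. *)
Lemma lindenbaum_sat (P : Type) (a b : form P) :
  sat (class a : lindenbaum_model P) b <-> (a ⊢ b).
Proof.
elim: b a => [p|||b IHb c IHc|b IHb c IHc|b IHb c IHc] a //=.
- by split=> // _; exact/entails_theorem/ipl_top.
- split=> [a1|abot]; first by apply/le_class; rewrite a1.
  by apply/le_anti; rewrite lex1 /=; exact/le_class.
- split=> [[/IHb ab /IHc ac]|abc]; first exact: entails_and.
  split; [apply/IHb|apply/IHc]; apply: entails_trans abc _.
    exact: ipl_andE1.
  exact: ipl_andE2.
- split=> [[y [z]]|abc].
    have [[d ->] [e ->]] := (classP y, classP z).
    case=> /IHb db /IHc ec; rewrite meet_class => /le_class ade.
    apply: entails_trans ade _; apply: entails_or.
      exact: entails_trans db (ipl_orI1 b c).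
    exact: entails_trans ec (ipl_orI2 b c).
  (* These are the least points forcing [b] and [c], and their meet is the class of [b ∨ c]. *)
  exists (class b), (class c); split; last by rewrite meet_class; exact/le_class.
    exact/IHb/entails_refl.
  exact/IHc/entails_refl.
- split=> [abc|abc y].
    (* The hypothesis is tested at the class of [a ∧ b], which lies above that of [a] and forces
       [b]. *)
    apply/entails_imp/IHc/abc; first by apply/le_class; exact: ipl_andE1.
    exact/IHb/ipl_andE2.
  have [d ->] := classP y => /le_class da /IHb db.
  by apply/IHc; apply: entails_mp db; exact: entails_trans abc.
Qed.

Theorem theorem5p21 (P : Type) (a : form P) :
  ipl_theorem a <-> forall (M : ds_model P) (x : M), x ⊩ a.
Proof.
split=> [|valid]; first exact: ipl_sound.
(* Validity at the class of [⊤] yields [⊤ ⊢ a]. *)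
apply: ipl_mp (ipl_top P).
exact/lindenbaum_sat/(valid (lindenbaum_model P)).
Qed.
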